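(* For all integers $n \geq 1$, $j \geq 0$, and $k, b \geq 1$, $$E(O_{\leq j,k,b}(n), D_{\leq j,k,b}(n)) = (k-1)(j+1)\,O_{j+1,k,b}(n).$$
   Context: A partition of a positive integer $n$ is a finite non-increasing sequence of positive integers, called parts, that sum to $n$; the empty partition is the unique partition of $0$. For integers $n,j\geq 0$ and $k,b\geq 1$: - $\mathcal{O}_{j,k,b}(n)$ is the set of partitions of $n$ with exactly $j$ different parts divisible by $kb$ (repetitions allowed), i.e. the set of distinct part sizes that occur in the partition and are divisible by $kb$ has exactly $j$ elements, with each such part allowed to occur any positive number of times. Put $O_{j,k,b}(n) = |\mathcal{O}_{j,k,b}(n)|$. - $\mathcal{D}_{j,k,b}(n)$ is the set of partitions of $n$ with exactly $j$ different parts that are both divisible by $b$ and appear at least $k$ times, i.e. there are exactly $j$ distinct part sizes $i$ with $b\mid i$ such that $i$ occurs at least $k$ times in the partition. Put $D_{j,k,b}(n) = |\mathcal{D}_{j,k,b}(n)|$. Put $O_{\leq j,k,b}(n) = \sum_{i=0}^{j} O_{i,k,b}(n)$ and $D_{\leq j,k,b}(n) = \sum_{i=0}^{j} D_{i,k,b}(n)$; these count the partitions in $\bigcup_{i=0}^{j}\mathcal{O}_{i,k,b}(n)$ and $\bigcup_{i=0}^{j}\mathcal{D}_{i,k,b}(n)$ respectively (disjoint unions). For a partition $\pi$, $\ell(\pi)$ denotes the number of parts of $\pi$, counted with multiplicity. If $a(n)$ and $b(n)$ count the partitions in sets $A(n)$ and $B(n)$ respectively, then $E(a(n),b(n)) =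 \sum_{\pi\in A(n)} \ell(\pi) - \sum_{\pi \in B(n)} \ell(\pi)$. In particular, $$E(O_{\leq j,k,b}(n), D_{\leq j,k,b}(n)) = \sum_{i=0}^{j}\Big(\sum_{\pi \in \mathcal{O}_{i,k,b}(n)} \ell(\pi) - \sum_{\pi \in \mathcal{D}_{i,k,b}(n)} \ell(\pi)\Big).$$ *)

(* Defs.v *)
From HB Require Import structures.
From mathcomp Require Import all_boot all_order all_algebra.

Set Implicit Arguments.
Unset Strict Implicit.
Unset Printing Implicit Defensive.

Import GRing.Theory.

Definition is_partition (n : nat) (s : seq nat) : bool :=
  [&& sorted geq s, all (leq 1) s & sumn s == n].

Record intpart (n : nat) := IntPart {
  parts :> seq nat;
  _ : is_partition n parts
}.

HB.instance Definition _ n := [isSub for @parts n].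
HB.instance Definition _ n := [Countable of intpart n by <:].

(* A partition of n has at most n parts, each at most n, so it occurs among
   the finitely many bounded sequences over 'I_n.+1; this gives finiteness. *)
Definition intpart_enum (n : nat) : seq (intpart n) :=
  undup (pmap insub [seq map val (bseqval s) | s : {bseq n of 'I_n.+1}]).

Lemma mem_intpart_enum (n : nat) (p : intpart n) : p \in intpart_enum n.
Proof.
rewrite mem_undup mem_pmap_sub; case: p => s /= /and3P[_ s_gt0 /eqP sum_s].
have le_size : size s <= n.
  rewrite -sum_s; elim: s s_gt0 {sum_s} => //= x s IHs /andP[x_gt0 /IHs].
  by rewrite -add1n; apply: leq_add.
have lt_s : all (fun x => x < n.+1) s.
  apply/allP=> x xs; rewrite ltnS -sum_s.
  elim: s xs {s_gt0 sum_s le_size} => //= y s IHs.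
  rewrite inE => /orP[/eqP-> | /IHs]; first exact: leq_addr.
  by move/leq_trans; apply; apply: leq_addl.
pose t := map (@inord n) s.
have size_t : size t <= n by rewrite size_map.
suff -> : s = map val (bseqval (Bseq size_t)) by apply: image_f.
rewrite /= -map_comp -[LHS]map_id; apply/eq_in_map=> x /(allP lt_s) lt_x.
by rewrite /= inordK.
Qed.

Lemma intpart_enumP (n : nat) : Finite.axiom (intpart_enum n).
Proof.
by apply: Finite.uniq_enumP; [exact: undup_uniq | exact: mem_intpart_enum].
Qed.

HB.instance Definition _ n := isFinite.Build (intpart n) (@intpart_enumP n).

(* [undup p] lists each part size occurring in p exactly once. *)
Definition Oset (j k b n : nat) : {set intpart n} :=
  [set p : intpart n | count (fun i => k * b %| i) (undup p) == j].

Definition Dset (j k b n : nat) : {set intpart n} :=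
  [set p : intpart n |
     count (fun i => (b %| i) && (k <= count_mem i p)) (undup p) == j].

Definition Ole_set (j k b n : nat) : {set intpart n} :=
  \bigcup_(i < j.+1) Oset i k b n.

Definition Dle_set (j k b n : nat) : {set intpart n} :=
  \bigcup_(i < j.+1) Dset i k b n.

Definition excess (n : nat) (A B : {set intpart n}) : int :=
  ((\sum_(p in A) size p)%N%:Z - (\sum_(p in B) size p)%N%:Z)%R.

(* Main.v *)
Require Import Defs.
From mathcomp Require Import all_boot all_order all_algebra.
From mathcomp Require Import zify.

Import GRing.Theory.

(** Write [o p] for the number of part sizes of [p] divisible by [k * b],
    [d p] for the number of those divisible by [b] and repeated at least [k]
    times, and [l p] for the number of parts.

    The heart of the matter is a bijection on marked partitions. Choose a set
    [T] of multiples of [b]. Partitions containing every [k * i], [i] in [T],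
    at least once correspond to partitions containing every [i] in [T] at least
    [k] times: trade one copy of [k * i] for [k] copies of [i]. The trade
    preserves the integer partitioned and adds [(k - 1) * #|T|] parts
    ([sum_size_exchange], [sum_size_marked]).

    For a fixed partition [p], the admissible marks [T] are exactly the subsets
    of a set of cardinal [o p], respectively [d p]. By the binomial theorem,
    summing [v ^ #|T|] over them gives [(1 + v) ^ o p], respectively
    [(1 + v) ^ d p]. Taking [v = 'X - 1], the
    sum of the trade over all [T] becomes the polynomial identity
      [sum_p l p 'X^(d p) = sum_p l p 'X^(o p) + (k - 1) ('X - 1) P^`()],
    with [P = sum_p 'X^(o p)]; the derivative accounts for the factor [#|T|]
    ([size_gen_exchange]). Adding the coefficients of degree at most [j] leaves
    the partition statistics on one side. On the other the factor ['X - 1]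
    makes the sum telescope to minus the coefficient of degree [j] in [P^`()],
    which is [(j + 1)] times the number of [p] with [o p = j + 1]. *)

(** * Exchanging parts of a partition *)

Section Exchange.

Implicit Types (r a s : seq nat) (n x : nat).

Definition submultiset r s := all (fun x => count_mem x r <= count_mem x s) r.

Lemma submultisetP r s :
  reflect (forall x, count_mem x r <= count_mem x s) (submultiset r s).
Proof.
apply: (iffP allP) => [h x | h x _] //.
by have [/h // | /count_memPn ->] := boolP (x \in r).
Qed.

Definition multidiff s r := foldl (fun t x => rem x t) s r.

Lemma count_multidiff s r x :
  count_mem x (multidiff s r) = count_mem x s - count_mem x r.
Proof.
elim: r s => [|y r IHr] s /=; first by rewrite subn0.
by rewrite IHr count_mem_rem subnDA.
Qed.

Lemma perm_multidiff s r : submultiset r s -> perm_eq s (r ++ multidiff s r).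
Proof.
move=> /submultisetP le_rs; apply/allP=> x _ /=.
by rewrite count_cat count_multidiff subnKC.
Qed.

Lemma intpart_sorted n (p : intpart n) : sorted geq p.
Proof. by case: p => s /= /and3P[]. Qed.

Lemma intpart_sumn n (p : intpart n) : sumn p = n.
Proof. by case: p => s /= /and3P[_ _ /eqP]. Qed.

Lemma intpart_notin0 n (p : intpart n) : 0 \notin (p : seq nat).
Proof. by case: p => s /= /and3P[_ /allP pos _]; apply/negP => /pos. Qed.

Lemma intpart_part_le n (p : intpart n) x : x \in (p : seq nat) -> x <= n.
Proof.
move=> xp; rewrite -[X in _ <= X](intpart_sumn n p).
by rewrite (perm_sumn (perm_to_rem xp)) leq_addr.
Qed.

Lemma intpart_perm_inj n (p q : intpart n) : perm_eq p q -> p = q.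
Proof.
move=> pq; apply: val_inj; apply: (sorted_eq _ _ _ _ pq);
  try exact: intpart_sorted.
- by move=> y x z /= xy yz; apply: leq_trans yz xy.
- by move=> x y /= xy; apply/eqP; rewrite eqn_leq andbC.
Qed.

(** The sequence built here partitions [n] when [r] is contained in [p], has
    the same sum as [a], and [a] has no zero entry; [p] itself serves as the
    default value otherwise. *)
Definition exchange n r a (p : intpart n) : intpart n :=
  insubd p (sort geq (a ++ multidiff p r)).

Section ExchangeTheory.

Context (n : nat) (r a : seq nat).
Hypotheses (sumn_eq : sumn r = sumn a) (mem0_eq : (0 \in r) = (0 \in a)).

Lemma exchange_perm (p : intpart n) : submultiset r p ->
  perm_eq (exchange n r a p) (a ++ multidiff p r).
Proof.
move=> rp; rewrite /exchange val_insubd.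
suff -> : is_partition n (sort geq (a ++ multidiff p r)) by rewrite perm_sort.
apply/and3P; split.
- by apply: sort_sorted => x y; apply: leq_total.
- rewrite all_sort; apply/allP => x; rewrite lt0n; apply: contraL => /eqP->.
  have := intpart_notin0 n p; rewrite (perm_mem (perm_multidiff _ _ rp)).
  by rewrite !mem_cat mem0_eq.
- rewrite (perm_sumn (permEl (perm_sort _ _))) sumn_cat -sumn_eq -sumn_cat.
  by rewrite -(perm_sumn (perm_multidiff _ _ rp)) intpart_sumn.
Qed.

Lemma exchange_submultiset (p : intpart n) :
  submultiset r p -> submultiset a (exchange n r a p).
Proof.
move=> rp; apply/submultisetP => x.
by rewrite (permP (exchange_perm p rp)) count_cat leq_addr.
Qed.

Lemma size_exchange (p : intpart n) : submultiset r p ->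
  size (exchange n r a p) + size r = size p + size a.
Proof.
move=> rp; rewrite (perm_size (exchange_perm p rp)).
by rewrite (perm_size (perm_multidiff _ _ rp)) !size_cat addnAC -addnA addnC.
Qed.

End ExchangeTheory.

Lemma exchangeK n r a (p : intpart n) :
  sumn r = sumn a -> (0 \in r) = (0 \in a) -> submultiset r p ->
  exchange n a r (exchange n r a p) = p.
Proof.
move=> sum_ra mem_ra rp.
have aq := exchange_submultiset n r a sum_ra mem_ra p rp.
apply: intpart_perm_inj; apply/allP => x _ /=.
rewrite (permP (exchange_perm n a r _ _ _ aq)) // count_cat count_multidiff.
rewrite (permP (exchange_perm n r a _ _ p rp)) // count_cat count_multidiff.
by have /submultisetP/(_ x) le_rp := rp; rewrite addKn subnKC.
Qed.

(** Removing [r] and adding [a] is undone by removing [a] and adding [r], so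
    exchanging is a bijection between the two index sets. The condition on [0]
    keeps the results free of zero parts: if [0] lies in both [r] and [a], no
    partition contains either of them and both sums are empty. *)
Lemma sum_size_exchange n r a (V : nmodType) (F : nat -> V) :
  sumn r = sumn a -> (0 \in r) = (0 \in a) ->
  (\sum_(q : intpart n | submultiset a q) F (size q + size r)%N =
   \sum_(p : intpart n | submultiset r p) F (size p + size a)%N)%R.
Proof.
move=> sum_ra mem_ra.
rewrite (reindex_onto (exchange n r a) (exchange n a r)) /=; last first.
  by move=> q aq; apply: exchangeK.
have dom (p : intpart n) :
    submultiset a (exchange n r a p) && (exchange n a r (exchange n r a p) == p)
    = submultiset r p.
  apply/andP/idP => [[aq /eqP <-] | rp]; first exact: exchange_submultiset.
  by rewrite exchangeK // exchange_submultiset.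
by rewrite (eq_bigl _ _ dom); apply: eq_bigr => p rp; rewrite size_exchange.
Qed.

End Exchange.

(** * Markable part sizes *)

Section Marks.

Context (k b n : nat).
Hypothesis k_gt0 : 1 <= k.

Implicit Types (p : intpart n) (T : {set 'I_n.+1}).

(** A part [k * i] is recorded by its quotient [i], so that marks on both sides
    of the exchange are the same sets. *)
Definition Omarks p : {set 'I_n.+1} :=
  [set i : 'I_n.+1 | (b %| i) && (k * i \in (p : seq nat))].

Definition Dmarks p : {set 'I_n.+1} :=
  [set i : 'I_n.+1 | (b %| i) && (k <= count_mem (i : nat) p)].

Lemma card_Omarks p : #|Omarks p| = count (fun i => k * b %| i) (undup p).
Proof.
rewrite cardE -(size_map (fun i : 'I_n.+1 => k * i)) -size_filter.
apply/perm_size/uniq_perm.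
- rewrite map_inj_uniq ?enum_uniq // => i j /eqP.
  by rewrite eqn_pmul2l // => /eqP/val_inj.
- by rewrite filter_uniq ?undup_uniq.
move=> x; rewrite mem_filter mem_undup; apply/mapP/andP.
- by move=> [i]; rewrite mem_enum inE => /andP[bi kip] ->; rewrite dvdn_pmul2l.
- move=> [/dvdnP[c def_x] xp]; have def_x' : x = k * (c * b) by lia.
  have lt_n : c * b < n.+1.
    have := intpart_part_le n p x xp; rewrite ltnS def_x'; apply: leq_trans.
    exact: leq_pmull.
  by exists (Ordinal lt_n); rewrite // mem_enum inE /= dvdn_mull //= -def_x'.
Qed.

Lemma card_Dmarks p :
  #|Dmarks p| =
  count (fun i => (b %| i) && (k <= count_mem i p)) (undup p).
Proof.
rewrite cardE -(size_map val) -size_filter; apply/perm_size/uniq_perm.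
- by rewrite map_inj_uniq ?enum_uniq //; apply: val_inj.
- by rewrite filter_uniq ?undup_uniq.
have memP x : k <= count_mem x p -> x \in (p : seq nat).
  by move=> le_k; rewrite -has_pred1 has_count (leq_trans k_gt0).
move=> x; rewrite mem_filter mem_undup; apply/mapP/andP.
- by move=> [i]; rewrite mem_enum inE => /andP[bi kip] -> /=; rewrite bi memP.
- move=> [/andP[bx kx] xp]; have lt_n : x < n.+1 by exact: intpart_part_le xp.
  by exists (Ordinal lt_n); rewrite // mem_enum inE /= bx.
Qed.

Definition removed T : seq nat := [seq k * val i | i <- enum T].

Definition added T : seq nat := flatten (nseq k [seq val i | i <- enum T]).

Lemma size_removed T : size (removed T) = #|T|.
Proof. by rewrite size_map cardE. Qed.

Lemma size_added T : size (added T) = k * #|T|.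
Proof.
by rewrite size_flatten /shape map_nseq sumn_nseq size_map -cardE mulnC.
Qed.

Lemma sumn_removed T : sumn (removed T) = sumn (added T).
Proof.
rewrite sumn_flatten map_nseq sumn_nseq /removed.
by elim: (enum T) => //= i s ->; lia.
Qed.

Lemma count_added T x :
  count_mem x (added T) = k * (x \in [seq val i | i <- enum T]).
Proof.
rewrite count_flatten map_nseq sumn_nseq count_uniq_mem 1?mulnC //.
by rewrite map_inj_uniq ?enum_uniq //; apply: val_inj.
Qed.

Lemma mem_added T x : (x \in added T) = (x \in [seq val i | i <- enum T]).
Proof. by rewrite -has_pred1 has_count count_added; case: (_ \in _); lia. Qed.

Lemma mem0_removed T : (0 \in removed T) = (0 \in added T).
Proof.
rewrite mem_added; apply/mapP/mapP => [] [i Ti] => [/esym/eqP | i0].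
- by rewrite muln_eq0 eqn0Ngt k_gt0 /= => /eqP i0; exists i.
- by exists i; rewrite // -i0 muln0.
Qed.

Lemma removed_uniq T : uniq (removed T).
Proof.
rewrite map_inj_uniq ?enum_uniq // => i j /eqP.
by rewrite eqn_pmul2l // => /eqP/val_inj.
Qed.

(** This and [sub_DmarksE] put the admissibility of a mark set into the form
    required by the exchange: the condition on divisibility by [b] is common to
    both sides, and what remains is a multiset inclusion. *)
Lemma sub_OmarksE p T :
  (T \subset Omarks p) =
  [forall i in T, b %| val i] && submultiset (removed T) p.
Proof.
apply/subsetP/andP => [sTO | [/forall_inP bT /submultisetP rp] i iT].
- split; first by apply/forall_inP => i /sTO; rewrite inE => /andP[].
  apply/allP => x xr; rewrite count_uniq_mem ?removed_uniq // xr.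
  case/mapP: xr => i; rewrite mem_enum => /sTO; rewrite inE => /andP[_ kip] ->.
  by rewrite -has_count has_pred1.
- rewrite inE bT //= -has_pred1 has_count; apply: leq_trans (rp _).
  by rewrite -has_count has_pred1; apply/mapP; exists i; rewrite ?mem_enum.
Qed.

Lemma sub_DmarksE p T :
  (T \subset Dmarks p) =
  [forall i in T, b %| val i] && submultiset (added T) p.
Proof.
apply/subsetP/andP => [sTD | [/forall_inP bT /submultisetP ap] i iT].
- split; first by apply/forall_inP => i /sTD; rewrite inE => /andP[].
  apply/allP => x; rewrite mem_added count_added => xT; rewrite xT muln1.
  by case/mapP: xT => i; rewrite mem_enum => /sTD; rewrite inE => /andP[_ ?] ->.
- rewrite inE bT //=; apply: leq_trans (ap _).
  by rewrite count_added map_f ?mem_enum ?muln1.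
Qed.

(** Trading one copy of each [k * i], [i] in [T], for [k] copies of [i] is an
    exchange of [removed T] for [added T], which have the same sum. *)
Lemma sum_size_marked T (V : nmodType) (F : nat -> V) :
  (\sum_(q : intpart n | T \subset Dmarks q) F (size q) =
   \sum_(p : intpart n | T \subset Omarks p) F (size p + k.-1 * #|T|)%N)%R.
Proof.
under eq_bigl do rewrite sub_DmarksE; under [RHS]eq_bigl do rewrite sub_OmarksE.
case: [forall i in T, _] => /=; last by rewrite !big_pred0.
(* The exchange identity counts #|T| on the left; the shift cancels it. *)
have := @sum_size_exchange n _ _ V (fun m => F (m - #|T|)%N)
  (sumn_removed T) (mem0_removed T).
rewrite size_removed size_added => main; transitivity
    (\sum_(q : intpart n | submultiset (added T) q)
       F (size q + #|T| - #|T|)%N)%R.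
  by apply: eq_bigr => q _; rewrite addnK.
rewrite main; apply: eq_bigr => p _; congr F.
by rewrite -[k in LHS](prednK k_gt0) mulSn addnCA addKn.
Qed.

End Marks.

(** * Generating polynomials *)

Section Generating.

Local Open Scope ring_scope.

Lemma sum_subsets_exp (I : finType) (R : comNzRingType) (A : {set I}) (v : R) :
  \sum_(T : {set I} | T \subset A) v ^+ #|T| = (1 + v) ^+ #|A|.
Proof.
rewrite exprDn.
rewrite (partition_big
  (fun T : {set I} => inord #|T| : 'I_(#|A|.+1)) xpredT) //=.
apply: eq_bigr => i _; rewrite expr1n mul1r -(cards_draws A i) -sumr_const.
have dom (T : {set I}) : (T \subset A) && (inord #|T| == i :> 'I_(#|A|.+1))
   = (T \in [set B : {set I} | B \subset A & #|B| == i]).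
  rewrite inE; have [sTA|//] := boolP (T \subset A).
  by rewrite -val_eqE /= inordK // ltnS subset_leq_card.
rewrite (eq_bigl _ _ dom); apply: eq_bigr => T; rewrite inE => /andP[_ /eqP->].
by [].
Qed.

Context (k b n : nat).
Hypothesis k_gt0 : (1 <= k)%N.

Let o (p : intpart n) := #|Omarks k b n p|.
Let d (p : intpart n) := #|Dmarks k b n p|.

(** Both sides expand over mark sets [T] with weight [('X - 1) ^+ #|T|]. The
    additional [(k - 1) * #|T|] parts created by the exchange contribute
    [#|T| * v ^+ #|T| = v * (v ^+ #|T|)^`()] with [v = 'X - 1], whence the
    derivative. *)
Lemma size_gen_exchange :
  \sum_(p : intpart n) (size p)%:R *: 'X^(d p) =
  \sum_(p : intpart n) (size p)%:R *: 'X^(o p)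
  + (k%:R - 1) *: (('X - 1) * (\sum_(p : intpart n) 'X^(o p))^`())
  :> {poly int}.
Proof.
pose v : {poly int} := 'X - 1.
have expand (A : {set 'I_n.+1}) : 'X^#|A| =
    \sum_(T : {set 'I_n.+1} | T \subset A) v ^+ #|T|.
  by rewrite sum_subsets_exp /v addrC subrK.
have deriv_v m : v * (v ^+ m)^`() = m%:R *: v ^+ m.
  rewrite deriv_exp [v^`()]derivB derivX derivC subr0 mul1r.
  case: m => [|m]; first by rewrite mulr0n mulr0 scale0r.
  by rewrite mulrnAr -exprS scaler_nat.
have swap (M : intpart n -> {set 'I_n.+1}) (F : intpart n -> int) :
    \sum_p F p *: 'X^#|M p| =
    \sum_(T : {set 'I_n.+1}) \sum_(p | T \subset M p) F p *: v ^+ #|T|.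
  under eq_bigr do rewrite expand scaler_sumr.
  by rewrite (exchange_big_dep xpredT).
have swap_deriv : v * (\sum_p 'X^(o p))^`() =
    \sum_(T : {set 'I_n.+1}) \sum_(p | T \subset Omarks k b n p)
      #|T|%:R *: v ^+ #|T|.
  under eq_bigr do rewrite expand.
  rewrite (exchange_big_dep xpredT) //= raddf_sum mulr_sumr.
  apply: eq_bigr => T _; rewrite raddf_sum mulr_sumr.
  by apply: eq_bigr => p _; rewrite deriv_v.
rewrite -/v swap_deriv !swap scaler_sumr -big_split; apply: eq_bigr => T _ /=.
rewrite (sum_size_marked k b n k_gt0 T _ (fun m => m%:R *: v ^+ #|T|)).
rewrite scaler_sumr -big_split; apply: eq_bigr => p _ /=.
rewrite scalerA -scalerDl natrD natrM; congr ((_ + _ * _) *: _).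
by rewrite -[k in RHS](prednK k_gt0) -natr1 addrK.
Qed.

Lemma coef_sum_scale_exp (c : intpart n -> int) (e : intpart n -> nat) i :
  (\sum_p c p *: 'X^(e p))`_i = \sum_(p | e p == i) c p.
Proof.
rewrite coef_sum [RHS]big_mkcond; apply: eq_bigr => p _.
by rewrite coefZ coefXn eq_sym; case: eqP; rewrite ?mulr1 ?mulr0.
Qed.

Lemma sum_coef_low (c : intpart n -> int) (e : intpart n -> nat) j :
  \sum_(i < j.+1) (\sum_p c p *: 'X^(e p))`_i = \sum_(p | (e p <= j)%N) c p.
Proof.
under eq_bigr do rewrite coef_sum_scale_exp big_mkcond.
rewrite exchange_big [RHS]big_mkcond; apply: eq_bigr => p _ /=.
rewrite -big_mkcond /=; case: leqP => [le_j | lt_j].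
  rewrite (big_pred1 (inord (e p))) // => i; apply/eqP/eqP => [-> | ->].
    by rewrite inord_val.
  by rewrite inordK.
rewrite big_pred0 // => i; apply: contraTF (ltn_ord i) => /eqP <-.
by rewrite -leqNgt.
Qed.

(** Telescoping: the coefficient of degree [i] of [('X - 1) * P] is the
    difference of two consecutive coefficients of [P]. *)
Lemma sum_coef_subX1 (P : {poly int}) j :
  \sum_(i < j.+1) (('X - 1) * P)`_i = - P`_j.
Proof.
have coefE i : (('X - 1) * P)`_i = (if i == 0%N then 0 else P`_i.-1) - P`_i.
  by rewrite mulrBl mul1r coefB coefXM.
elim: j => [|j IHj]; first by rewrite big_ord1 coefE sub0r.
by rewrite big_ord_recr /= IHj coefE /= addrA addNr sub0r.
Qed.

Lemma excess_marks j :
  \sum_(p : intpart n | (o p <= j)%N) (size p)%:R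
  - \sum_(p : intpart n | (d p <= j)%N) (size p)%:R
  = (k%:R - 1) * (j%:R + 1) * #|[set p : intpart n | o p == j.+1]|%:R :> int.
Proof.
rewrite -!sum_coef_low size_gen_exchange.
under [X in _ - X]eq_bigr do rewrite coefD coefZ.
rewrite big_split opprD addNKr -mulr_sumr sum_coef_subX1 mulrN opprK -mulrA.
congr (_ * _); rewrite coef_deriv -[_ *+ j.+1]mulr_natl natr1; congr (_ * _).
have -> : \sum_p 'X^(o p) = \sum_p 1 *: 'X^(o p) :> {poly int}.
  by apply: eq_bigr => p _; rewrite scale1r.
rewrite coef_sum_scale_exp -[RHS]sumr_const.
by apply: eq_bigl => p; rewrite inE.
Qed.

End Generating.

(** * The corollary *)

Lemma mem_Ole_set j k b n (p : intpart n) :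
  (p \in Ole_set j k b n) = (count (fun i => k * b %| i) (undup p) <= j).
Proof.
apply/bigcupP/idP => [[i _] | le_j].
  by rewrite inE => /eqP ->; rewrite -ltnS.
by exists (Ordinal (le_j : _ < j.+1)); rewrite // inE.
Qed.

Lemma mem_Dle_set j k b n (p : intpart n) :
  (p \in Dle_set j k b n) =
  (count (fun i => (b %| i) && (k <= count_mem i p)) (undup p) <= j).
Proof.
apply/bigcupP/idP => [[i _] | le_j].
  by rewrite inE => /eqP ->; rewrite -ltnS.
by exists (Ordinal (le_j : _ < j.+1)); rewrite // inE.
Qed.

Theorem corollary1p3 (n j k b : nat) (hn : 1 <= n) (hk : 1 <= k) (hb : 1 <= b) :
  excess (Ole_set j k b n) (Dle_set j k b n) =
  ((k%:Z - 1) * (j%:Z + 1) * #|Oset j.+1 k b n|%:Z)%R.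
Proof.
have main := excess_marks k b n hk j.
rewrite /excess -!natz !natr_sum.
have -> : Oset j.+1 k b n = [set p | #|Omarks k b n p| == j.+1].
  by apply/setP => p; rewrite !inE card_Omarks.
rewrite -main; congr (_ - _)%R; apply: eq_bigl => p.
- by rewrite mem_Ole_set card_Omarks.
- by rewrite mem_Dle_set card_Dmarks.
Qed.
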